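(* Let $\alpha,\beta$ be real with $\alpha>-1$, $\beta>-1$, and let $c$ be any real number with $c\neq1$. For real $\epsilon\neq0$ put $q=-e^{\epsilon}$, $a=-e^{\epsilon\alpha}$, $b=-e^{\epsilon\beta}$, and let $u_n=A_{n-1}C_n$ and $b_n=1-A_n-C_n$ be the recurrence coefficients of the monic big $q$-Jacobi polynomials (recalled in the context). Then, as $\epsilon\to0$, these coefficients converge to $$u_n^{(-1)}=\begin{cases}\dfrac{(1-c)^2n(\alpha+\beta+n)}{(\alpha+\beta+2n)^2},& n\text{ even},\\[2mm] \dfrac{(1+c)^2(\alpha+n)(\beta+n)}{(\alpha+\beta+2n)^2},& n\text{ odd},\end{cases}\qquad (n\ge1)$$ and $$b_n^{(-1)}=\begin{cases}-c+\dfrac{(c-1)n}{\alpha+\beta+2n}+\dfrac{(1+c)(\beta+n+1)}{\alpha+\beta+2n+2},& n\text{ even},\\[2mm] c+\dfrac{(1-c)(n+1)}{\alpha+\beta+2n+2}-\dfrac{(c+1)(\beta+n)}{\alpha+\beta+2n},& n\text{ odd},\end{cases}\qquad (n\ge0)$$ (where for $n=0$ the term $\frac{(c-1)n}{\alpha+\beta+2n}$ is read as $0$). Moreover, all $b_n^{(-1)}$ are real and $u_n^{(-1)}>0$ for all $n\ge1$; hence the polynomials $P_n^{(-1)}$ defined by $P_{-1}^{(-1)}=0$, $P_0^{(-1)}=1$ and $$P_{n+1}^{(-1)}(x)+b_n^{(-1)}P_n^{(-1)}(x)+u_n^{(-1)}P_{n-1}^{(-1)}(x)=xP_n^{(-1)}(x)$$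 are positive definite orthogonal polynomials, i.e. orthogonal with respect to a positive definite linear functional on polynomials.
   Context: The monic big $q$-Jacobi polynomials $P_n(x)=P_n(x;a,b,c)$ with parameters $a,b,c$ satisfy $P_{n+1}(x)+b_nP_n(x)+u_nP_{n-1}(x)=xP_n(x)$ with $u_n=A_{n-1}C_n$, $b_n=1-A_n-C_n$, where $$A_n=\frac{(1-aq^{n+1})(1-abq^{n+1})(1-cq^{n+1})}{(1-abq^{2n+1})(1-abq^{2n+2})},\qquad C_n=-acq^{n+1}\frac{(1-q^n)(1-abc^{-1}q^n)(1-bq^n)}{(1-abq^{2n+1})(1-abq^{2n})}.$$ Here $C_0=0$, and the product $c(1-abc^{-1}q^n)$ occurring in $C_n$ is read as $c-abq^n$, so that $c=0$ is allowed.
   Formalization: The claims that u_n^(-1)>0 for all n≥1 and that the P_n^(-1) are positive definite orthogonal polynomials are proved with the added assumption c≠-1, since for c=-1 all u_n^(-1) with n odd vanish; the two limits are proved for all real c≠1. *)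

(* Defs.v *)
From HB Require Import structures.
From mathcomp Require Import all_boot all_order all_algebra.
From mathcomp Require Import all_classical all_reals all_analysis.

Set Implicit Arguments.
Unset Strict Implicit.
Unset Printing Implicit Defensive.

Import Order.TTheory GRing.Theory Num.Theory.
Import numFieldNormedType.Exports.

Local Open Scope ring_scope.

Section BigqJacobi.
Context {R : realType}.
Implicit Types (a b c q alpha beta : R) (n : nat).

Definition qJacobi_A a b c q n : R :=
  (1 - a * q ^+ n.+1) * (1 - a * b * q ^+ n.+1) * (1 - c * q ^+ n.+1) /
  ((1 - a * b * q ^+ (2 * n).+1) * (1 - a * b * q ^+ (2 * n).+2)).

(* The usual factor c * (1 - a b c^-1 q^n) is written c - a b q^n, so that
   c = 0 is allowed.  The factor 1 - q^n makes the value at n = 0 equal to 0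
   even if a b = 1, since x / 0 = 0. *)
Definition qJacobi_C a b c q n : R :=
  - a * q ^+ n.+1 * (1 - q ^+ n) * (c - a * b * q ^+ n) * (1 - b * q ^+ n) /
  ((1 - a * b * q ^+ (2 * n).+1) * (1 - a * b * q ^+ (2 * n))).

(* Only meaningful for n >= 1. *)
Definition qJacobi_u a b c q n : R :=
  qJacobi_A a b c q n.-1 * qJacobi_C a b c q n.

Definition qJacobi_b a b c q n : R :=
  1 - qJacobi_A a b c q n - qJacobi_C a b c q n.

Definition m1Jacobi_u alpha beta c n : R :=
  if odd n then
    (1 + c) ^+ 2 * (alpha + n%:R) * (beta + n%:R) /
      (alpha + beta + 2 * n%:R) ^+ 2
  else
    (1 - c) ^+ 2 * n%:R * (alpha + beta + n%:R) /
      (alpha + beta + 2 * n%:R) ^+ 2.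

(* At n = 0 the term with numerator (c - 1) * n is 0, also if
   alpha + beta = 0. *)
Definition m1Jacobi_b alpha beta c n : R :=
  if odd n then
    c + (1 - c) * (n%:R + 1) / (alpha + beta + 2 * n%:R + 2)
      - (c + 1) * (beta + n%:R) / (alpha + beta + 2 * n%:R)
  else
    - c + (c - 1) * n%:R / (alpha + beta + 2 * n%:R)
      + (1 + c) * (beta + n%:R + 1) / (alpha + beta + 2 * n%:R + 2).

(* Positivity of the coefficients u_n with n odd requires c <> -1. *)
Lemma m1Jacobi_u_cN1 alpha beta n : odd n -> m1Jacobi_u alpha beta (-1) n = 0.
Proof. by rewrite /m1Jacobi_u => ->; rewrite subrr expr0n !mul0r. Qed.

End BigqJacobi.

Section OrthogonalPolynomials.
Context {R : realType}.
Implicit Types (b u : nat -> R) (L : {scalar {poly R}}) (P : nat -> {poly R}).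

(* The pair (P_{n-1}, P_n), starting from (P_{-1}, P_0) = (0, 1); the value of
   u at 0 is irrelevant. *)
Fixpoint recpoly_pair b u n : {poly R} * {poly R} :=
  if n is m.+1 then
    let: (p, p') := recpoly_pair b u m in
    (p', 'X * p' - b m *: p' - u m *: p)
  else (0, 1).

Definition recpoly b u n : {poly R} := (recpoly_pair b u n).2.

Lemma recpoly0 b u : recpoly b u 0 = 1.
Proof. by []. Qed.

Lemma recpoly1 b u : recpoly b u 1 + b 0 *: recpoly b u 0 = 'X * recpoly b u 0.
Proof. by rewrite /recpoly /= scaler0 subr0 subrK. Qed.

Lemma recpolyS b u n :
  recpoly b u n.+2 + b n.+1 *: recpoly b u n.+1 + u n.+1 *: recpoly b u n
  = 'X * recpoly b u n.+1.
Proof.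
rewrite /recpoly /=; case: (recpoly_pair b u n) => p p' /=.
by rewrite addrAC subrK subrK.
Qed.

(* Chihara's definition; it contains L (p ^+ 2) > 0 for all p != 0. *)
Definition positive_definite L : Prop :=
  forall p : {poly R}, p != 0 -> (forall x, 0 <= p.[x]) -> 0 < L p.

Definition orthogonal_polynomials L P : Prop :=
  [/\ forall n, size (P n) = n.+1,
      forall m n, m != n -> L (P m * P n) = 0 &
      forall n, L (P n ^+ 2) != 0].

End OrthogonalPolynomials.

(* Main.v *)
Require Import Defs.
From HB Require Import structures.
From mathcomp Require Import all_boot all_order all_algebra.
From mathcomp Require Import all_classical all_reals all_analysis.
From mathcomp Require Import ring lra.
From mathcomp Require polyrcf.

Set Implicit Arguments.
Unset Strict Implicit.
Unset Printing Implicit Defensive.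

Import Order.TTheory GRing.Theory Num.Theory.
Import numFieldNormedType.Exports.

Local Open Scope classical_set_scope.
Local Open Scope ring_scope.

(** Since a b = e^(eps (alpha + beta)), every factor 1 - q^k, 1 - a q^k,
    1 - b q^k or 1 - a b q^k has the form 1 + E or 1 - E, with E = e^(eps x)
    for some x, and the parity of k decides which.  A factor 1 + E tends to 2,
    whereas 1 - E vanishes like - eps x.  For either parity of n, exactly one
    of these factors has the form 1 - E in the numerator of A_n and of C_n, and
    exactly one in each denominator.  Dividing both by eps therefore gives
    finite limits (qJacobi_A_cvg and qJacobi_C_cvg; C_0 is identically 0), from
    which those of u_n and b_n follow algebraically.

    The limits u_n are positive because alpha + n, beta + n and alpha + beta + n
    are positive at the indices where they occur, so orthogonality is an
    instance of Favard's theorem (favard).  There the functional L is built from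
    the numbers it must assign to x^k P_n: the recurrence for P_n, together with
    L (P_n) = 0 for n >= 1 and L 1 = 1, determines all of them, by recursion
    on k (mixed_moment).  They vanish for k < n and equal u_1 ... u_n for k = n,
    so the P_n are orthogonal with positive norms, and splitting off leading
    terms gives L (p ^+ 2) > 0 for p != 0.  Positive definiteness also concerns
    polynomials that are merely nonnegative on the line; each of these is a sum
    of squares (nonneg_poly_sum_of_squares). *)

(** * Limits of the recurrence coefficients *)

Section RecurrenceCoefficientLimits.
Variable R : realType.
Implicit Types (x alpha beta c : R) (n : nat).

Lemma exprN_expR (eps : R) n :
  (- expR eps) ^+ n = (-1) ^+ odd n * expR (eps * n%:R).
Proof. by rewrite (exprNn (expR eps)) signr_odd expRM_natr. Qed.

Lemma cvg_expRZ x : expR (eps * x) @[eps --> (0 : R)^'] --> (1 : R).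
Proof.
suff : expR (eps * x) @[eps --> (0 : R)^'] --> expR (0 * x).
  by rewrite mul0r expR0.
apply: continuous_cvg.
  exact: continuous_expR.
apply: cvgM; last exact: cvg_cst.
exact: cvg_within.
Qed.

(** The quotient is the difference quotient at 0 of 1 - expR (eps * x). *)
Lemma cvg_expR_quotient x :
  (1 - expR (eps * x)) / eps @[eps --> (0 : R)^'] --> - x.
Proof.
pose f := fun eps : R => 1 - expR (eps * x).
have df : is_derive (0 : R) (1 : R) f (- x).
  apply: is_derive_eq.
  by rewrite !mul0r expR0 /GRing.scale /=; ring.
have : h^-1 *: ((f \o shift 0) (h *: (1 : R)) - f 0) @[h --> (0 : R)^']
    --> 'D_1 f 0.
  exact: ex_derive.
rewrite derive_val; apply: cvg_trans; apply: near_eq_cvg.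
apply: nearW => h; rewrite /f /= mul0r expR0 subrr subr0 addr0 /GRing.scale /=.
by rewrite mulr1 mulrC.
Qed.

Lemma cvg_1BexpRZ k x :
  1 - k * expR (eps * x) @[eps --> (0 : R)^'] --> 1 - k.
Proof.
rewrite -[X in _ --> _ - X]mulr1; apply: cvgB; first exact: cvg_cst.
by apply: cvgM; [exact: cvg_cst | exact: cvg_expRZ].
Qed.

Lemma cvg_addexpRZ k x : k + expR (eps * x) @[eps --> (0 : R)^'] --> k + 1.
Proof. by apply: cvgD; [exact: cvg_cst | exact: cvg_expRZ]. Qed.

Lemma mul_expR_qexp (eps x : R) n :
  expR (eps * x) * (- expR eps) ^+ n = (-1) ^+ odd n * expR (eps * (x + n%:R)).
Proof. by rewrite exprN_expR mulrCA -expRD -mulrDr. Qed.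

Section LimitToMinusOne.
Variables alpha beta c : R.
Let a (eps : R) := - expR (eps * alpha).
Let b (eps : R) := - expR (eps * beta).
Let q (eps : R) := - expR eps.

Lemma mul_a_qexp eps n :
  a eps * q eps ^+ n = - ((-1) ^+ odd n * expR (eps * (alpha + n%:R))).
Proof. by rewrite mulNr mul_expR_qexp. Qed.

Lemma mul_b_qexp eps n :
  b eps * q eps ^+ n = - ((-1) ^+ odd n * expR (eps * (beta + n%:R))).
Proof. by rewrite mulNr mul_expR_qexp. Qed.

Lemma mul_ab_qexp eps n :
  a eps * b eps * q eps ^+ n
  = (-1) ^+ odd n * expR (eps * (alpha + beta + n%:R)).
Proof. by rewrite mulrNN -expRD -mulrDr mul_expR_qexp. Qed.

(** Used with e = eps, to move one eps under the vanishing factor of the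
    numerator and one under that of the denominator. *)
Lemma divff_cancel (e x y : R) : e != 0 -> x / y = (x / e) / (y / e).
Proof. by move=> e_neq0; rewrite invf_div mulrA divfK. Qed.

(** Of the two factors of the denominator, 1 - a b q^(2n+2) vanishes and
    1 - a b q^(2n+1) tends to 2.  In the numerator 1 - a b q^(n+1) vanishes when
    n is odd, 1 - a q^(n+1) when n is even. *)
Lemma qJacobi_A_cvg n : alpha + beta + 2 * n%:R + 2 != 0 ->
  qJacobi_A (a eps) (b eps) c (q eps) n @[eps --> (0 : R)^'] -->
    (if odd n then (1 - c) * (alpha + beta + n%:R + 1)
     else (1 + c) * (alpha + n%:R + 1)) / (alpha + beta + 2 * n%:R + 2).
Proof.
move=> den_neq0.
have den_cvg : (1 + expR (eps * (alpha + beta + (2 * n).+1%:R)))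
    * ((1 - expR (eps * (alpha + beta + (2 * n).+2%:R))) / eps)
    @[eps --> (0 : R)^'] --> (1 + 1) * - (alpha + beta + (2 * n).+2%:R).
  by apply: cvgM; [exact: cvg_addexpRZ | exact: cvg_expR_quotient].
have denE : alpha + beta + (2 * n).+2%:R = alpha + beta + 2 * n%:R + 2.
  by rewrite -(addn2 (2 * n)) natrD natrM addrA.
have den_neq0' : (1 + 1) * - (alpha + beta + (2 * n).+2%:R) != 0.
  by rewrite denE mulrN oppr_eq0 mulf_neq0 // lt0r_neq0.
case: ifPn => [n_odd|/negbTE n_even].
- have num_cvg : (1 + expR (eps * (alpha + n.+1%:R)))
      * ((1 - expR (eps * (alpha + beta + n.+1%:R))) / eps)
      * (1 - c * expR (eps * n.+1%:R)) @[eps --> (0 : R)^']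
      --> (1 + 1) * - (alpha + beta + n.+1%:R) * (1 - c).
    apply: cvgM; last exact: cvg_1BexpRZ.
    by apply: cvgM; [exact: cvg_addexpRZ | exact: cvg_expR_quotient].
  have -> : (1 - c) * (alpha + beta + n%:R + 1) / (alpha + beta + 2 * n%:R + 2)
      = ((1 + 1) * - (alpha + beta + n.+1%:R) * (1 - c))
        / ((1 + 1) * - (alpha + beta + (2 * n).+2%:R)).
    by rewrite denE -natr1; field.
  apply: cvg_trans (cvgM num_cvg (cvgV den_neq0' den_cvg)).
  apply: near_eq_cvg; near=> eps.
  have eps_neq0 : eps != 0 by near: eps; exact: nbhs_dnbhs_neq.
  rewrite /qJacobi_A mul_a_qexp !mul_ab_qexp exprN_expR /= oddM /= n_odd /=.
  rewrite expr1 expr0 !mulN1r !mul1r !opprK [RHS](divff_cancel _ _ eps_neq0).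
  by congr (_ / _); ring.
- have num_cvg : ((1 - expR (eps * (alpha + n.+1%:R))) / eps)
      * (1 + expR (eps * (alpha + beta + n.+1%:R)))
      * (1 - (- c) * expR (eps * n.+1%:R)) @[eps --> (0 : R)^']
      --> - (alpha + n.+1%:R) * (1 + 1) * (1 - - c).
    apply: cvgM; last exact: cvg_1BexpRZ.
    by apply: cvgM; [exact: cvg_expR_quotient | exact: cvg_addexpRZ].
  have -> : (1 + c) * (alpha + n%:R + 1) / (alpha + beta + 2 * n%:R + 2)
      = (- (alpha + n.+1%:R) * (1 + 1) * (1 - - c))
        / ((1 + 1) * - (alpha + beta + (2 * n).+2%:R)).
    by rewrite denE -natr1; field.
  apply: cvg_trans (cvgM num_cvg (cvgV den_neq0' den_cvg)).
  apply: near_eq_cvg; near=> eps.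
  have eps_neq0 : eps != 0 by near: eps; exact: nbhs_dnbhs_neq.
  rewrite /qJacobi_A mul_a_qexp !mul_ab_qexp exprN_expR /= oddM /= n_even /=.
  rewrite expr1 expr0 !mulN1r !mul1r !opprK [RHS](divff_cancel _ _ eps_neq0).
  by congr (_ / _); ring.
Unshelve. all: by end_near. Qed.

(** The vanishing factor of the denominator is now 1 - a b q^(2n); in the
    numerator it is 1 - b q^n when n is odd, 1 - q^n when n is even.  At n = 0
    the latter is identically 0, and so are C_0 and the stated limit, whatever
    alpha + beta is. *)
Lemma qJacobi_C_cvg n : (n == 0) || (alpha + beta + 2 * n%:R != 0) ->
  qJacobi_C (a eps) (b eps) c (q eps) n @[eps --> (0 : R)^'] -->
    (if odd n then (1 + c) * (beta + n%:R) else (1 - c) * n%:R)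
    / (alpha + beta + 2 * n%:R).
Proof.
have [->|n_neq0 /= den_neq0] := eqVneq n 0.
  move=> _; rewrite /= mulr0 mul0r; apply: cvg_near_cst; apply: nearW => eps.
  by rewrite /qJacobi_C expr0 subrr mulr0 !mul0r.
have den_cvg : (1 + expR (eps * (alpha + beta + (2 * n).+1%:R)))
    * ((1 - expR (eps * (alpha + beta + (2 * n)%:R))) / eps)
    @[eps --> (0 : R)^'] --> (1 + 1) * - (alpha + beta + (2 * n)%:R).
  by apply: cvgM; [exact: cvg_addexpRZ | exact: cvg_expR_quotient].
have den_neq0' : (1 + 1) * - (alpha + beta + (2 * n)%:R) != 0.
  by rewrite natrM mulrN oppr_eq0 mulf_neq0 // lt0r_neq0.
case: ifPn => [n_odd|/negbTE n_even].
- have num_cvg : expR (eps * (alpha + n.+1%:R)) * (1 + expR (eps * n%:R))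
      * (c + expR (eps * (alpha + beta + n%:R)))
      * ((1 - expR (eps * (beta + n%:R))) / eps) @[eps --> (0 : R)^']
      --> 1 * (1 + 1) * (c + 1) * - (beta + n%:R).
    apply: cvgM; last exact: cvg_expR_quotient.
    apply: cvgM; last exact: cvg_addexpRZ.
    by apply: cvgM; [exact: cvg_expRZ | exact: cvg_addexpRZ].
  have -> : (1 + c) * (beta + n%:R) / (alpha + beta + 2 * n%:R)
      = (1 * (1 + 1) * (c + 1) * - (beta + n%:R))
        / ((1 + 1) * - (alpha + beta + (2 * n)%:R)).
    by rewrite natrM; field.
  apply: cvg_trans (cvgM num_cvg (cvgV den_neq0' den_cvg)).
  apply: near_eq_cvg; near=> eps.
  have eps_neq0 : eps != 0 by near: eps; exact: nbhs_dnbhs_neq.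
  rewrite /qJacobi_C (mulNr (a eps) (q eps ^+ n.+1)) (mul_a_qexp eps n.+1).
  rewrite (mul_b_qexp eps n) !mul_ab_qexp (exprN_expR eps n) /= oddM.
  rewrite /= n_odd /= expr1 expr0 !mulN1r !mul1r !opprK.
  by rewrite [RHS](divff_cancel _ _ eps_neq0); congr (_ / _); ring.
- have num_cvg : - expR (eps * (alpha + n.+1%:R))
      * ((1 - expR (eps * n%:R)) / eps)
      * (c - expR (eps * (alpha + beta + n%:R)))
      * (1 + expR (eps * (beta + n%:R))) @[eps --> (0 : R)^']
      --> - 1 * - n%:R * (c - 1) * (1 + 1).
    apply: cvgM; last exact: cvg_addexpRZ.
    apply: cvgM; last by apply: cvgB; [exact: cvg_cst | exact: cvg_expRZ].
    by apply: cvgM; [apply: cvgN; exact: cvg_expRZ | exact: cvg_expR_quotient].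
  have -> : (1 - c) * n%:R / (alpha + beta + 2 * n%:R)
      = (- 1 * - n%:R * (c - 1) * (1 + 1))
        / ((1 + 1) * - (alpha + beta + (2 * n)%:R)).
    by rewrite natrM; field.
  apply: cvg_trans (cvgM num_cvg (cvgV den_neq0' den_cvg)).
  apply: near_eq_cvg; near=> eps.
  have eps_neq0 : eps != 0 by near: eps; exact: nbhs_dnbhs_neq.
  rewrite /qJacobi_C (mulNr (a eps) (q eps ^+ n.+1)) (mul_a_qexp eps n.+1).
  rewrite (mul_b_qexp eps n) !mul_ab_qexp (exprN_expR eps n) /= oddM.
  rewrite /= n_even /= expr1 expr0 !mulN1r !mul1r !opprK.
  by rewrite [RHS](divff_cancel _ _ eps_neq0); congr (_ / _); ring.
Unshelve. all: by end_near. Qed.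

End LimitToMinusOne.
End RecurrenceCoefficientLimits.

(** * Nonnegative polynomials as sums of squares *)

Section NonnegativePolynomials.
Variable R : realType.
Implicit Types (p s : {poly R}) (r : R).

Lemma horner_ge0_adherent p r :
    (forall d, 0 < d -> exists2 y, `|y - r| < d & 0 <= p.[y]) -> 0 <= p.[r].
Proof.
move=> p_ge0; rewrite leNgt; apply/negP => pr_lt0.
have pr_gt0 : 0 < - p.[r] by rewrite oppr_gt0.
have [d d_gt0 dP] := polyrcf.poly_cont r p pr_gt0.
have [y /dP + py_ge0] := p_ge0 d d_gt0.
by rewrite ltr_norml => /andP[_]; lra.
Qed.

Lemma horner_ge0_right p r : (forall y, r < y -> 0 <= p.[y]) -> 0 <= p.[r].
Proof.
move=> p_ge0; apply: horner_ge0_adherent => d d_gt0; exists (r + d / 2).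
  by rewrite addrAC subrr add0r gtr0_norm; lra.
by apply: p_ge0; lra.
Qed.

Lemma horner_ge0_left p r : (forall y, y < r -> 0 <= p.[y]) -> 0 <= p.[r].
Proof.
move=> p_ge0; apply: horner_ge0_adherent => d d_gt0; exists (r - d / 2).
  by rewrite addrAC subrr add0r normrN gtr0_norm; lra.
by apply: p_ge0; lra.
Qed.

(** Write p = ('X - r) t.  The sign of t changes with that of x - r, so r is a
    root of t as well by continuity. *)
Lemma nonneg_root_factor p r : (forall x, 0 <= p.[x]) -> root p r ->
  exists2 s, p = ('X - r%:P) ^+ 2 * s & forall x, 0 <= s.[x].
Proof.
move=> p_ge0 /factor_theorem[t pE].
have tE x : p.[x] = t.[x] * (x - r) by rewrite pE !hornerE.
have t_right y : r < y -> 0 <= t.[y].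
  by move=> ry; have := p_ge0 y; rewrite tE pmulr_lge0 // subr_gt0.
have t_left y : y < r -> 0 <= (- t).[y].
  move=> yr; have := p_ge0 y.
  by rewrite tE hornerN oppr_ge0 nmulr_lge0 // subr_lt0.
have /factor_theorem[s sE] : root t r.
  apply/eqP/le_anti; rewrite (horner_ge0_right t_right) andbT.
  by have := horner_ge0_left t_left; rewrite hornerN oppr_ge0.
exists s; first by rewrite pE sE; ring.
have s_right y : r < y -> 0 <= s.[y].
  move=> ry; have := t_right y ry; rewrite sE !hornerE.
  by rewrite pmulr_lge0 // subr_gt0.
move=> x; have [xr|rx|->] := ltgtP x r; last exact: horner_ge0_right.
  have := t_left x xr; rewrite sE !hornerE oppr_ge0.
  by rewrite nmulr_lle0 // subr_lt0.
exact: s_right.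
Qed.

(** For p not constant the leading coefficient is positive, and p - p(0) has the
    same one, hence is positive far to the right.  Comparing with p(0) makes one
    bound serve on both half-lines in the search for a minimum. *)
Lemma nonneg_poly_ge_horner0 p : (forall x, 0 <= p.[x]) ->
  exists B, forall x, B <= x -> p.[0] <= p.[x].
Proof.
move=> p_ge0; have [p_small|p_big] := leqP (size p) 1.
  by exists 0 => x _; rewrite (size1_polyC p_small) !hornerC.
have p_lc : 0 < lead_coef p.
  rewrite lt_neqAle eq_sym lead_coef_eq0 -size_poly_eq0 -lt0n.
  rewrite (ltn_trans _ p_big) //=.
  rewrite leNgt; apply/negP => p_lc.
  have [|B BP] := @polyrcf.poly_pinfty_gt_lc R (- p).
    by rewrite lead_coefN oppr_gt0.
  have := BP B (lexx B); have := p_ge0 B; rewrite lead_coefN hornerN; lra.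
have q_lc : lead_coef (p - p.[0]%:P) = lead_coef p.
  by rewrite lead_coefDl // size_polyN (leq_ltn_trans (size_polyC_leq1 _)).
have [|B BP] := @polyrcf.poly_pinfty_gt_lc R (p - p.[0]%:P).
  by rewrite q_lc.
exists B => x /BP; rewrite q_lc !hornerE; lra.
Qed.

Lemma nonneg_poly_has_min p : (forall x, 0 <= p.[x]) ->
  exists r, forall x, p.[r] <= p.[x].
Proof.
move=> p_ge0.
have [B BP] := nonneg_poly_ge_horner0 p_ge0.
have [B' BP'] : exists B, forall x, B <= x -> p.[0] <= p.[- x].
  have [|B' BP'] := @nonneg_poly_ge_horner0 (p \Po - 'X).
    by move=> x; rewrite horner_comp.
  by exists B' => x /BP'; rewrite !horner_comp !hornerE oppr0.
pose M := Num.max 0 (Num.max B B').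
have M_ge0 : 0 <= M by rewrite le_max lexx.
have BM : B <= M by rewrite !le_max lexx ?orbT.
have BM' : B' <= M by rewrite !le_max lexx ?orbT.
have [|r r_in rP] := @EVT_min R (horner p) (- M) M ltac:(lra).
  by apply: continuous_subspaceT; exact: continuous_horner.
have r0 : p.[r] <= p.[0] by apply: rP; rewrite in_itv /= oppr_le0 M_ge0.
exists r => x; have [xM|Mx] := leP x M; last first.
  by apply: le_trans r0 (BP _ _); lra.
have [Mx|xM'] := leP (- M) x; first by apply: rP; rewrite in_itv /= Mx xM.
by apply: le_trans r0 _; rewrite -[x]opprK; apply: BP'; lra.
Qed.

(** Induction on the degree: if p attains its minimum at r, then p - p(r) is
    nonnegative with a root at r, so p = p(r) + ('X - r)^2 s with s nonnegative,
    of lower degree. *)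
Lemma nonneg_poly_sum_of_squares p : (forall x, 0 <= p.[x]) ->
  exists ts : seq {poly R}, p = \sum_(t <- ts) t ^+ 2.
Proof.
have [n] := ubnP (size p); elim: n p => // n IHn p p_lt p_ge0.
have [r rP] := nonneg_poly_has_min p_ge0.
have [s sE s_ge0] : exists2 s, p - p.[r]%:P = ('X - r%:P) ^+ 2 * s
    & forall x, 0 <= s.[x].
  apply: nonneg_root_factor; last by rewrite /root !hornerE subrr.
  by move=> x; rewrite !hornerE subr_ge0.
have pE : p = (Num.sqrt p.[r])%:P ^+ 2 + ('X - r%:P) ^+ 2 * s.
  by rewrite -sE -rmorphXn /= sqr_sqrtr // addrC subrK.
have [s0|s_neq0] := eqVneq s 0.
  by exists [:: (Num.sqrt p.[r])%:P]; rewrite big_seq1 {1}pE s0 mulr0 addr0.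
have sz : size (('X - r%:P) ^+ 2 * s) = (size s).+2.
  by rewrite size_monicM ?monic_exp ?monicXsubC // size_exp_XsubC addSn.
have [|ts sts] := IHn s _ s_ge0.
  have : (size (p - p.[r]%:P)%R <= maxn (size p) 1)%N.
    rewrite (leq_trans (size_polyD _ _)) // size_polyN.
    by rewrite geq_max leq_maxl leq_max size_polyC_leq1 orbT.
  rewrite sE sz leq_max ltnS ltn0 orbF => /ltnW s_lt.
  exact: leq_trans s_lt _.
exists ((Num.sqrt p.[r])%:P :: [seq ('X - r%:P) * t | t <- ts]).
rewrite big_cons big_map {1}pE sts mulr_sumr; congr (_ + _).
by apply: eq_bigr => t _; rewrite exprMn.
Qed.

End NonnegativePolynomials.

(** * The moment functional of a three-term recurrence *)

Lemma size_sub_lead_coef (A : nzRingType) (p q : {poly A}) n :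
  size p = n.+1 -> size q = n.+1 -> lead_coef p = lead_coef q ->
  (size (p - q)%R <= n)%N.
Proof.
move=> p_sz q_sz; rewrite !lead_coefE p_sz q_sz => /= pq.
apply/leq_sizeP => j; rewrite leq_eqVlt coefB => /orP[/eqP <-|nj].
  by rewrite pq subrr.
by rewrite !nth_default ?p_sz ?q_sz ?subrr.
Qed.

Section MomentFunctional.
Variable R : realType.
Implicit Types (m b u : nat -> R) (p q : {poly R}).

Definition moment_functional m p : R := \sum_(i < size p) p`_i * m i.

Lemma moment_functional_widen m p N : (size p <= N)%N ->
  moment_functional m p = \sum_(i < N) p`_i * m i.
Proof.
move=> pN; rewrite /moment_functional.
rewrite (big_ord_widen _ (fun i => p`_i * m i) pN).
rewrite big_mkcond /=; apply: eq_bigr => i _; case: ltnP => // pi.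
by rewrite nth_default // mul0r.
Qed.

(** The sum defining the functional has a length that depends on p; padding it
    to a common length makes linearity visible. *)
Lemma moment_functional_linear m : linear_for *%R (moment_functional m).
Proof.
move=> a p q; pose N := maxn (size p) (size q).
rewrite !(@moment_functional_widen m _ N) ?leq_maxl ?leq_maxr //; last first.
  rewrite (leq_trans (size_polyD _ _)) // geq_max leq_maxr andbT.
  by rewrite (leq_trans (size_scale_leq _ _)) // leq_maxl.
rewrite mulr_sumr -big_split; apply: eq_bigr => i _ /=.
by rewrite coefD coefZ mulrDl mulrA.
Qed.

HB.instance Definition _ m :=
  GRing.isLinear.Build R {poly R} R *%R (moment_functional m)
    (moment_functional_linear m).

(** The value on 'X^k * P n of the functional sought: row 0 prescribes its
    values on the P n, and x P_n = P_(n+1) + b_n P_n + u_n P_(n-1) gives each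
    further row from the previous one.  Column 0 lists the moments. *)
Fixpoint mixed_moment b u k n : R :=
  if k is k'.+1 then
    mixed_moment b u k' n.+1 + b n * mixed_moment b u k' n
    + (if n is n'.+1 then u n * mixed_moment b u k' n' else 0)
  else (n == 0)%:R.

Section Favard.
Variables b u : nat -> R.
Let P := recpoly b u.
Let L : {scalar {poly R}} := moment_functional (mixed_moment b u ^~ 0).
Let h n : R := \prod_(i < n) u i.+1.

Lemma recpolyS0 : P 1 = 'X - (b 0)%:P.
Proof.
by rewrite -alg_polyC -(addrK (b 0 *: 1) (P 1)) recpoly1 recpoly0 mulr1.
Qed.

Lemma recpolySS n : P n.+2 = 'X * P n.+1 - b n.+1 *: P n.+1 - u n.+1 *: P n.
Proof. by rewrite /P -recpolyS; ring. Qed.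

Lemma recpoly_monic_size n : (P n \is monic) /\ size (P n) = n.+1.
Proof.
have step k p : p \is monic -> size p = k.+1 -> forall q, (size q <= k.+1)%N ->
    ('X * p + q \is monic) /\ size ('X * p + q) = k.+2.
  move=> p_mon p_sz q q_sz.
  have Xp_sz : size ('X * p) = k.+2.
    by rewrite size_monicM ?monicX ?monic_neq0 // size_polyX p_sz.
  rewrite monicE lead_coefDl ?size_polyDl ?Xp_sz //; split=> //.
  by rewrite -monicE monicMl ?monicX.
suff [? _] : ((P n \is monic) /\ size (P n) = n.+1)
    /\ ((P n.+1 \is monic) /\ size (P n.+1) = n.+2) by [].
elim: n => [|n [[mn sn] [mn1 sn1]]].
  rewrite recpolyS0 /P recpoly0 monic1 size_poly1 monicXsubC size_XsubC.
  by [].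
split=> //; rewrite recpolySS -addrA; apply: step => //.
rewrite (leq_trans (size_polyD _ _)) // !size_polyN geq_max.
by rewrite !(leq_trans (size_scale_leq _ _)) ?sn ?sn1.
Qed.

Lemma moment_Xn k : L 'X^k = mixed_moment b u k 0.
Proof.
rewrite /L /= /moment_functional size_polyXn big_ord_recr /=.
rewrite coefXn eqxx mul1r big1 ?add0r // => i _.
by rewrite coefXn ltn_eqF ?mul0r.
Qed.

(** Both sides obey the recurrence in n, and for n = 0 they agree by the
    choice of the moments.  The induction carries two consecutive indices. *)
Lemma moment_Xn_recpoly k n : L ('X^k * P n) = mixed_moment b u k n.
Proof.
suff: forall k, L ('X^k * P n) = mixed_moment b u k n
    /\ L ('X^k * P n.+1) = mixed_moment b u k n.+1 by case/(_ k).
elim: n {k} => [|n IHn] k.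
  rewrite {1}/P recpoly0 mulr1 moment_Xn; split=> //.
  rewrite recpolyS0 mulrBr -exprSr linearB /= [_ * _%:P]mulrC mul_polyC.
  by rewrite linearZ /= !moment_Xn /=; ring.
have [_ IHS] := IHn k; split=> //.
rewrite recpolySS !mulrBr mulrA -exprSr !linearB /= -!scalerAr !scalarZ.
by rewrite (IHn k).1 (IHn k.+1).2 IHS /=; ring.
Qed.

Lemma mixed_moment_small k n : (k < n)%N -> mixed_moment b u k n = 0.
Proof.
elim: k n => [|k IHk] [|n] //=; rewrite ltnS => kn.
by rewrite !IHk ?mulr0 ?addr0 ?(leqW (leqW kn)) ?leqW.
Qed.

Lemma mixed_moment_diag n : mixed_moment b u n n = h n.
Proof.
elim: n => [|n IHn]; first by rewrite /h big_ord0.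
rewrite /= IHn !mixed_moment_small ?ltnS //.
by rewrite /h big_ord_recr /=; ring.
Qed.

(** Orthogonality: p is a combination of the 'X^k with k < n. *)
Lemma moment_lower_recpoly p n : (size p <= n)%N -> L (p * P n) = 0.
Proof.
move=> p_sz; rewrite -[p]coefK poly_def mulr_suml linear_sum big1 // => i _.
rewrite -scalerAl linearZ /= moment_Xn_recpoly mixed_moment_small ?mulr0 //.
exact: leq_trans (ltn_ord i) p_sz.
Qed.

(** P n differs from 'X^n by a polynomial of lower degree, orthogonal to P n. *)
Lemma moment_recpoly_sqr n : L (P n ^+ 2) = h n.
Proof.
have [Pn_mon Pn_sz] := recpoly_monic_size n.
have Pn_lt : (size (P n - 'X^n)%R <= n)%N.
  by apply: size_sub_lead_coef; rewrite ?size_polyXn // lead_coefXn; apply/eqP.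
have -> : P n ^+ 2 = 'X^n * P n + (P n - 'X^n) * P n by ring.
rewrite linearD /= moment_Xn_recpoly mixed_moment_diag.
by rewrite moment_lower_recpoly ?addr0.
Qed.

Hypothesis u_gt0 : forall n, (1 <= n)%N -> 0 < u n.

Lemma norm_recpoly_gt0 n : 0 < h n.
Proof. by apply: prodr_gt0 => i _; apply: u_gt0. Qed.

(** Induction on the degree: with p = a P_k + r and r of degree less than k,
    orthogonality gives L (p ^+ 2) = a^2 u_1 ... u_k + L (r ^+ 2). *)
Lemma moment_sqr_gt0 p : p != 0 -> 0 < L (p ^+ 2).
Proof.
have [n] := ubnP (size p); elim: n p => // n IHn p p_lt p_neq0.
have [k p_sz] : exists k, size p = k.+1.
  by exists (size p).-1; rewrite prednK // size_poly_gt0.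
have [Pk_mon Pk_sz] := recpoly_monic_size k.
pose a := lead_coef p; pose r := p - a *: P k.
have a_neq0 : a != 0 by rewrite lead_coef_eq0.
have r_sz : (size r <= k)%N.
  apply: size_sub_lead_coef => //; first by rewrite size_scale.
  by rewrite lead_coefZ (eqP Pk_mon) mulr1.
have pE : p ^+ 2 = (a ^+ 2) *: (P k ^+ 2) + (2 * a) *: (r * P k) + r ^+ 2.
  by rewrite -[p](subrK (a *: P k)) -/r -!mul_polyC !polyCM; ring.
rewrite pE !linearD !scalarZ moment_recpoly_sqr moment_lower_recpoly //.
rewrite mulr0 addr0; apply: ltr_pwDl.
  by rewrite mulr_gt0 ?norm_recpoly_gt0 ?exprn_even_gt0.
have [->|r_neq0] := eqVneq r 0; first by rewrite expr0n linear0.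
by apply/ltW/IHn => //; rewrite (leq_ltn_trans r_sz) // -ltnS -p_sz.
Qed.

(** Favard's theorem, for positive coefficients. *)
Lemma favard : exists L : {scalar {poly R}},
  positive_definite L /\ orthogonal_polynomials L (recpoly b u).
Proof.
exists L; split.
  move=> p p_neq0 /nonneg_poly_sum_of_squares[ts pE].
  have L_ge0 t : 0 <= L (t ^+ 2).
    by have [->|/moment_sqr_gt0/ltW//] := eqVneq t 0; rewrite expr0n /= linear0.
  move: p_neq0; rewrite pE {p pE} linear_sum /=.
  elim: ts => [|t ts IHts]; first by rewrite !big_nil eqxx.
  rewrite !big_cons; have [->|t_neq0] := eqVneq t 0.
    by rewrite expr0n /= linear0 !add0r.
  move=> _; apply: ltr_pwDl; first exact: moment_sqr_gt0.
  by apply: sumr_ge0 => i _; exact: L_ge0.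
split=> [n|i j|n]; first by case: (recpoly_monic_size n).
- wlog lt_ij : i j / (i < j)%N => [hw ij|_].
    have /orP[/hw->//|/hw] : (i < j)%N || (j < i)%N by rewrite -neq_ltn.
    by rewrite eq_sym mulrC => ->.
  by apply: moment_lower_recpoly; case: (recpoly_monic_size i) => _ ->.
- by rewrite moment_recpoly_sqr gt_eqF // norm_recpoly_gt0.
Qed.
End Favard.
End MomentFunctional.

(** * The limit polynomials *)

(** For n odd the factors alpha + n and beta + n are positive as n >= 1; for n
    even alpha + beta + n is, as then n >= 2. *)
Lemma m1Jacobi_u_gt0 (R : realType) (alpha beta c : R) n :
  -1 < alpha -> -1 < beta -> c != 1 -> c != -1 -> (1 <= n)%N ->
  0 < m1Jacobi_u alpha beta c n.
Proof.
move=> halpha hbeta c1 cN1 n_gt0.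
have n_ge1 : 1 <= n%:R :> R by rewrite ler1n.
have den_gt0 : 0 < (alpha + beta + 2 * n%:R) ^+ 2 by apply: exprn_gt0; lra.
rewrite /m1Jacobi_u; case: ifPn => n_odd; apply: divr_gt0 => //.
  have : 0 < (1 + c) ^+ 2 by rewrite exprn_even_gt0 //= addrC addr_eq0.
  by move=> c_gt0; apply: mulr_gt0; [apply: mulr_gt0|]; rewrite //; lra.
have n_ge2 : 2 <= n%:R :> R.
  by rewrite ler_nat; case: n n_gt0 n_odd {n_ge1 den_gt0} => [|[]].
have : 0 < (1 - c) ^+ 2 by rewrite exprn_even_gt0 //= subr_eq0 eq_sym.
by move=> c_gt0; apply: mulr_gt0; [apply: mulr_gt0|]; rewrite //; lra.
Qed.

Theorem mainTheorem2 (R : realType) (alpha beta c : R)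
    (halpha : -1 < alpha) (hbeta : -1 < beta) (hc : c != 1) :
  [/\ forall n : nat, (1 <= n)%N ->
        qJacobi_u (- expR (eps * alpha)) (- expR (eps * beta)) c (- expR eps) n
          @[eps --> (0 : R)^'] --> m1Jacobi_u alpha beta c n,
      forall n : nat,
        qJacobi_b (- expR (eps * alpha)) (- expR (eps * beta)) c (- expR eps) n
          @[eps --> (0 : R)^'] --> m1Jacobi_b alpha beta c n,
      c != -1 -> forall n : nat, (1 <= n)%N -> 0 < m1Jacobi_u alpha beta c n &
      c != -1 -> exists L : {scalar {poly R}},
        positive_definite L /\
        orthogonal_polynomials L
          (recpoly (m1Jacobi_b alpha beta c) (m1Jacobi_u alpha beta c))].
Proof.
have den_neq0 n : alpha + beta + 2 * n%:R + 2 != 0.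
  by have := ler0n R n; move=> ?; apply: lt0r_neq0; lra.
have den_neq0' n : alpha + beta + 2 * n.+1%:R != 0.
  by rewrite -(natr1 n) mulrDr mulr1 addrA.
split=> [[//|n] _|n|cN1 n|cN1].
- have -> : m1Jacobi_u alpha beta c n.+1 =
      (if odd n then (1 - c) * (alpha + beta + n%:R + 1)
       else (1 + c) * (alpha + n%:R + 1)) / (alpha + beta + 2 * n%:R + 2)
      * ((if odd n.+1 then (1 + c) * (beta + n.+1%:R) else (1 - c) * n.+1%:R)
         / (alpha + beta + 2 * n.+1%:R)).
    have := den_neq0 n; rewrite /m1Jacobi_u /= -(natr1 n).
    rewrite (mulrDr 2) mulr1 !addrA => d0.
    by case: (odd n) => /=; field.
  apply: cvgM; first exact: qJacobi_A_cvg.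
  by apply: qJacobi_C_cvg; rewrite den_neq0'.
- have -> : m1Jacobi_b alpha beta c n =
      1 - (if odd n then (1 - c) * (alpha + beta + n%:R + 1)
       else (1 + c) * (alpha + n%:R + 1)) / (alpha + beta + 2 * n%:R + 2)
      - (if odd n then (1 + c) * (beta + n%:R) else (1 - c) * n%:R)
         / (alpha + beta + 2 * n%:R).
    (* At n = 0 the denominator alpha + beta can be 0, below the numerator 0. *)
    rewrite /m1Jacobi_b; case: n => [|n].
      by have := den_neq0 0%N; rewrite /= !mulr0 !mul0r !addr0 => d0; field.
    move: (den_neq0 n.+1) (den_neq0' n).
    by move: (n.+1%:R : R) (odd n.+1) => x [] d1 d0; field; rewrite d0 d1.
  apply: cvgB; last by apply: qJacobi_C_cvg; case: n.
  by apply: cvgB; [exact: cvg_cst | exact: qJacobi_A_cvg].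
- exact: m1Jacobi_u_gt0.
- by apply: favard => n; exact: m1Jacobi_u_gt0.
Qed.
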